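(* Let $n\ge 2$ be an integer, let $\delta_1,\delta_2\in\mathbb{R}$, and let $\mathbf{a}=\{a_0,a_1,\dots\}$ and $\mathbf{b}=\{b_0,b_1,\dots\}$ be infinite sequences with $a_i,b_i\in\{0,1,\dots,n-1\}$ for all $i$, with associated location functions $\mathcal{L}_{\mathbf{a}},\mathcal{L}_{\mathbf{b}}$. Then the $n$-grids $\mathcal{G}(\delta_1,\mathcal{L}_{\mathbf{a}})$ and $\mathcal{G}(\delta_2,\mathcal{L}_{\mathbf{b}})$ are adjacent if and only if both of the following hold: (i) $\delta_1-\delta_2$ is $n$-far; (ii) $$0<\liminf_{j\to+\infty}\left|\frac{\mathcal{L}_{\mathbf{a}}(j)-\mathcal{L}_{\mathbf{b}}(j)}{n^j}\right|\le\limsup_{j\to+\infty}\left|\frac{\mathcal{L}_{\mathbf{a}}(j)-\mathcal{L}_{\mathbf{b}}(j)}{n^j}\right|<1.$$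
   Context: Fix an integer $n\ge 2$; $\mathbb{N}=\{0,1,2,\dots\}$. General dyadic grid with base $n$ ($n$-grid): a collection $\mathcal{G}$ of left-closed, right-open intervals on $\mathbb{R}$ such that (i) every $Q\in\mathcal{G}$ has length $n^k$ for some $k\in\mathbb{Z}$; (ii) $Q\cap R\in\{Q,R,\emptyset\}$ for all $Q,R\in\mathcal{G}$; (iii) for each fixed $k\in\mathbb{Z}$ the intervals of $\mathcal{G}$ of length $n^k$ form a partition of $\mathbb{R}$. Far numbers: let $\Sigma$ be the set of pairs of integers $(m,k)$ with either $m\ge 0$, $k\in\mathbb{Z}$, or $m<0$, $k\ne 0$. A real number $\delta$ is $n$-far if there is $C>0$ (possibly depending on $\delta$ but not on $m,k$) with $\left|\delta-\frac{k}{n^m}\right|\ge\frac{C}{n^m}$ for all $(m,k)\in\Sigma$. Location function: for a sequence $\mathbf{a}=\{a_0,a_1,\dots\}$ with $a_i\in\{0,1,\dots,n-1\}$, $\mathcal{L}_{\mathbf{a}}:\mathbb{N}\to\mathbb{N}$ is given by $\mathcal{L}_{\mathbf{a}}(0)=0$ and $\mathcal{L}_{\mathbf{a}}(j)=\sum_{i=0}^{j-1}a_i n^i$ for $j\ge 1$. The grid $\mathcal{G}(\delta,\mathcal{L}_{\mathbf{a}})$, for $\delta\in\mathbb{R}$, is the union over $m\in\mathbb{Z}$ of its $m$-th generations $\mathcal{G}(\delta,\mathcal{L}_{\mathbf{a}})_m$, where for $m\ge 0$ $$\mathcal{G}(\delta,\mathcal{L}_{\mathbf{a}})_m=\left\{\left[\delta+\tfrac{k}{n^m},\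 \delta+\tfrac{k+1}{n^m}\right):k\in\mathbb{Z}\right\},$$ and for $m<0$ $$\mathcal{G}(\delta,\mathcal{L}_{\mathbf{a}})_m=\left\{\left[\delta+\mathcal{L}_{\mathbf{a}}(-m)+\tfrac{k}{n^m},\ \delta+\mathcal{L}_{\mathbf{a}}(-m)+\tfrac{k+1}{n^m}\right):k\in\mathbb{Z}\right\}.$$ This is an $n$-grid. Adjacency: two $n$-grids $\mathcal{G}_1,\mathcal{G}_2$ are adjacent if there is a constant $C>0$, independent of $Q$, such that for each bounded interval $Q\subset\mathbb{R}$ of positive length there is an interval $I$ with $Q\subset I$, $|I|\le C|Q|$, and $I\in\mathcal{G}_1$ or $I\in\mathcal{G}_2$ (here $|\cdot|$ is length). *)

(* Defs.v *)
From mathcomp Require Import all_boot all_order all_algebra.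
From mathcomp Require Import all_classical all_reals all_analysis.
From mathcomp Require Import ring lra.

Set Implicit Arguments.
Unset Strict Implicit.
Unset Printing Implicit Defensive.

Import Order.TTheory GRing.Theory Num.Theory.
Import numFieldNormedType.Exports.

Local Open Scope classical_set_scope.
Local Open Scope ring_scope.

(* The length of an interval of the real line is its Lebesgue measure. *)
Definition len {R : realType} (I : set R) : \bar R := lebesgue_measure I.

Definition is_ngrid (R : realType) (n : nat) (G : set (set R)) : Prop :=
  [/\ forall Q, G Q -> exists x y : R, Q = `[x, y[%classic,
      forall Q, G Q -> exists k : int, len Q = (n%:R ^ k)%:E,
      forall Q S, G Q -> G S ->
        [\/ Q `&` S = Q, Q `&` S = S | Q `&` S = set0]
    & forall k : int, partition [set Q | G Q /\ len Q = (n%:R ^ k)%:E] id setT].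

Record ngrid (R : realType) (n : nat) := NGrid {
  ngrid_set : set (set R);
  ngridP : is_ngrid n ngrid_set }.

Definition adjacent_grids (R : realType) (n : nat) (G1 G2 : ngrid R n) : Prop :=
  exists2 C : R, 0 < C &
    forall Q : set R, is_interval Q -> bounded_set Q -> (0 < len Q)%E ->
      exists I : set R,
        [/\ Q `<=` I, (len I <= C%:E * len Q)%E & ngrid_set G1 I \/ ngrid_set G2 I].

Definition far_index (m k : int) : Prop := 0 <= m \/ (m < 0 /\ k != 0).

Definition is_far (R : realType) (n : nat) (d : R) : Prop :=
  exists2 C : R, 0 < C &
    forall m k : int, far_index m k ->
      `|d - k%:~R / n%:R ^ m| >= C / n%:R ^ m.

Definition location (n : nat) (a : nat -> 'I_n) (j : nat) : nat :=
  (\sum_(i < j) a i * n ^ i)%N.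

(* For m < 0 the natural number -m is written `|m|%N. *)
Definition generation_origin (R : realType) (d : R) (L : nat -> nat) (m : int)
    : R :=
  if 0 <= m then d else d + (L `|m|%N)%:R.

Definition generation (R : realType) (n : nat) (d : R) (L : nat -> nat)
    (m : int) : set (set R) :=
  [set Q | exists k : int,
    Q = `[generation_origin d L m + k%:~R / n%:R ^ m,
          generation_origin d L m + (k + 1)%:~R / n%:R ^ m[%classic].

Definition grid (R : realType) (n : nat) (d : R) (L : nat -> nat)
    : set (set R) :=
  \bigcup_(m in [set: int]) generation n d L m.

Section GridIsNGrid.
Variables (R : realType) (n : nat) (n_ge2 : (2 <= n)%N).
Variables (d : R) (a : nat -> 'I_n).

Let L := location a.
Let o := generation_origin d L.

Let pow_gt0 (m : int) : (0 : R) < n%:R ^ m.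
Proof. by rewrite exprz_gt0// ltr0n ltnW. Qed.

Let pow_neq0 (m : int) : (n%:R ^ m : R) != 0.
Proof. by rewrite gt_eqF. Qed.

Let address (m : int) (x : R) : int := Num.floor ((x - o m) * n%:R ^ m).

Let cell (m k : int) : set R :=
  `[o m + k%:~R / n%:R ^ m, o m + (k + 1)%:~R / n%:R ^ m[%classic.

Let cellE m k : cell m k = [set x | address m x = k].
Proof.
rewrite /cell /address; apply/seteqP.
have E x : (x \in `[o m + k%:~R / n%:R ^ m, o m + (k + 1)%:~R / n%:R ^ m[) =
    (k%:~R <= (x - o m) * n%:R ^ m < (k + 1)%:~R).
  by rewrite in_itv /= -ler_pdivrMr// -ltr_pdivlMr// lerBrDl ltrBlDl.
split=> x /=; first by rewrite E; exact: floor_def.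
by rewrite E => <-; exact: floor_itv.
Qed.

Let len_cell m k : len (cell m k) = (n%:R ^ (- m))%:E.
Proof.
rewrite /len /cell lebesgue_measure_itv /= lte_fin ltrD2l.
rewrite ltr_pM2r ?invr_gt0// ltr_int ltzD1 lexx -EFinD; congr EFin.
by rewrite intrD invr_expz; ring.
Qed.

Let origin_step m : exists c : int, (o (m + 1) - o m) * n%:R ^ (m + 1) = c%:~R.
Proof.
rewrite /o /generation_origin.
case: m => j; first by exists 0; rewrite subrr mul0r.
have n0 : (n%:R : R) != 0 by rewrite pnatr_eq0 -lt0n ltnW.
have -> : Negz j + 1 = - (j%:Z) by rewrite NegzE; lra.
exists (- (a j : nat)%:Z).
have -> : (if 0 <= - j%:Z then d else d + (L `|- j%:Z|%N)%:R) = d + (L j)%:R.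
  case: j => [|j] /=; first by rewrite /L /location big_ord0 addr0.
  by [].

have -> : (0 <= Negz j) = false by [].
rewrite /= /L /location big_ord_recr /= natrD natrM natrX -exprnN mulrNz.
have nj : (n%:R ^+ j : R) != 0 by rewrite expf_neq0.
by rewrite -pmulrn; field.
Qed.

Let address_step m : exists g : int -> int,
  forall x, address m x = g (address (m + 1) x).
Proof.
have [c Hc] := origin_step m.
exists (fun k => ((k + c) %/ n)%Z) => x.
rewrite /address; set y := (x - o (m + 1)) * _.
have n0 : (n%:R : R) != 0 by rewrite pnatr_eq0 -lt0n ltnW.
have n0' : (0 : R) < n%:R by rewrite ltr0n ltnW.
have nz : (n : int) != 0 by rewrite eqz_nat -lt0n ltnW.
have -> : (x - o m) * n%:R ^ m = (y + c%:~R) / n%:R.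
  apply/(canRL (mulfK n0)); rewrite -Hc /y -mulrDl.
  by rewrite -mulrA -{2}[n%:R]expr1z -expfzDr//; congr (_ * _); ring.
set k := Num.floor y.
have /andP[ky yk] : k%:~R <= y < (k + 1)%:~R := floor_itv y.
apply: floor_def.
set q := (_ %/ _)%Z.
have E := divz_eq (k + c) n; rewrite -/q in E.
have r0 := modz_ge0 (k + c) nz.
have ngt0 : 0 < (n : int) by rewrite ltz_nat ltnW.
have rn : ((k + c) %% n)%Z + 1 <= n by rewrite lezD1 ltz_pmod.
move: ((k + c) %% n)%Z q E r0 rn => r q E r0 rn.
rewrite ler_pdivlMr// ltr_pdivrMr//.
have ER : k%:~R + c%:~R = q%:~R * n%:R + r%:~R :> R.
  by rewrite -intrD E intrD intrM.
move: r0 rn; rewrite -(ler0z R) -(ler_int R) intrD => r0 rn.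
move: yk; rewrite !intrD mulrDl => yk.
apply/andP; split; first lra.
by rewrite mul1r; move: rn yk; rewrite -!pmulrn; lra.
Qed.

Let address_mono m (p : nat) : exists g : int -> int,
  forall x, address m x = g (address (m + p) x).
Proof.
elim: p => [|p [g Hg]]; first by exists id => x; rewrite addr0.
have [h Hh] := address_step (m + p).
exists (g \o h) => x; rewrite Hg Hh /=.
by rewrite -addrA -PoszD addn1.
Qed.

Let cell_nested m k m' k' : m <= m' ->
  cell m k `&` cell m' k' = cell m' k' \/ cell m k `&` cell m' k' = set0.
Proof.
move=> mm'.
have [g] := address_mono m `|m' - m|%N.
rewrite gez0_abs ?subr_ge0// [m + _]addrC subrK => Hg.
rewrite !cellE; have [<-|gk] := eqVneq (g k') k; [left|right].
  by apply/seteqP; split=> x /= => [[]|<-].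
apply/seteqP; split=> x //= [xk xk'].
by move: gk; rewrite -xk Hg xk' eqxx.
Qed.

Lemma grid_is_ngrid : is_ngrid n (grid n d (location a)).
Proof.
have gridE Q : grid n d (location a) Q <-> exists m k, Q = cell m k.
  by split=> [[m _ [k ->]]|[m [k ->]]]; [exists m, k | exists m => //; exists k].
split.
- by move=> Q /gridE[m [k ->]]; eexists; eexists.
- by move=> Q /gridE[m [k ->]]; exists (- m); rewrite len_cell.
- move=> Q S /gridE[m [k ->]] /gridE[m' [k' ->]].
  have [mm'|/ltW mm'] := leP m m'.
    by have [->|->] := cell_nested k k' mm'; [apply: Or32|apply: Or33].
  by rewrite setIC; have [->|->] := cell_nested k' k mm';
     [apply: Or31|apply: Or33].
- move=> p.
  have genE Q : grid n d (location a) Q /\ len Q = (n%:R ^ p)%:E <->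
      exists k, Q = cell (- p) k.
    split=> [[/gridE[m [k ->]]]|[k ->]].
      rewrite len_cell => -[] /ieexprIz H.
      by exists k; rewrite -H ?opprK// ?ltr0n ?(ltnW n_ge2)//
        pnatr_eq1 gtn_eqF.
    by split; [apply/gridE; exists (- p), k|rewrite len_cell opprK].
  split.
  + apply/seteqP; split=> x // _.
    exists (cell (- p) (address (- p) x)); last by rewrite cellE.
    by apply/genE; eexists.
  + move=> Q S /genE[k ->] /genE[k' ->] [x []].
    by rewrite !cellE /= => -> ->.
  + move=> Q /genE[k ->].
    exists (o (- p) + k%:~R / n%:R ^ (- p)).
    rewrite /cell /= in_itv /= lexx /= ltrD2l.
    by rewrite ltr_pM2r ?invr_gt0// ltr_int ltzD1.
Qed.

End GridIsNGrid.

Definition location_grid (R : realType) (n : nat) (n_ge2 : (2 <= n)%N) (d : R)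
    (a : nat -> 'I_n) : ngrid R n :=
  NGrid (grid_is_ngrid n_ge2 d a).

Definition location_gap (R : realType) (n : nat) (a b : nat -> 'I_n) (j : nat)
    : R :=
  `|((location a j)%:R - (location b j)%:R) / n%:R ^+ j|.

(* Main.v *)
Require Import Defs.
From mathcomp Require Import all_boot all_order all_algebra.
From mathcomp Require Import all_classical all_reals all_analysis.
From mathcomp Require Import ring lra.

(** Both grids consist, at scale n^k, of the intervals of length n^k cut out
    by a translate of n^k * Z, so their mutual position at that scale is the
    distance between the two translates.  Adjacency says exactly that this
    distance is at least a fixed proportion of n^k, uniformly in k
    ([adjacent_separated], [separated_adjacent]).

    If endpoints of the two grids at scale n^k nearly coincide, a short
    interval around both lies in no cell of comparable length: a cell having
    one of these endpoints in its interior must, by nestedness, swallow the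
    whole cell of length n^k starting there.  Conversely, if the endpoints stay
    apart, choose the scale so that an interval Q of length l is shorter than
    the separation: when Q fits in neither of the two cells that contain its
    infimum, the right ends of both are within l of this infimum, hence too
    close to each other.

    It remains to read the separation arithmetically.  Write d for
    delta1 - delta2 and g j for the difference of the two location functions
    at j.  At the fine scales n^-m with m >= 0 the separation is the
    inequality defining far numbers.  At the coarse scales it reads
    c * n^j <= |d + g j - k * n^j| for all integers k.  Each single j is taken
    care of by the inequality at scale 1, since g j and n^j are integers, so
    only large j matter; there d is negligible before n^j, and because
    |g j| < n^j the inequality says that |g j| / n^j stays away from 0 (k = 0)
    and from 1 (k = 1 or -1), which is the condition on liminf and limsup
    ([separated_gap], [far_gap_separated]).  The far inequalities for m < 0
    follow in the same way: one scale suffices for finitely many m, and d is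
    negligible for the others ([separated_is_far]). *)

Import Order.TTheory GRing.Theory Num.Theory.
Import numFieldNormedType.Exports.

Local Open Scope ring_scope.

(** * Inferior and superior limits of real sequences *)

Section Limits.
Local Set Implicit Arguments.
Local Unset Strict Implicit.
Local Open Scope classical_set_scope.
Local Open Scope ring_scope.
Context {R : realType}.
Implicit Types (u : nat -> R) (l : R).

Lemma limn_esup_ltP u l : (limn_esup (fun j => (u j)%:E) < l%:E)%E <->
  exists2 c, c < l & \forall j \near \oo, u j <= c.
Proof.
rewrite /limn_esup limf_esupE; split=> [|[c cl [N _ uc]]].
  move=> /ereal_inf_lt[_ [V VF <-]].
  case E : ereal_sup => [c| |] // cl.
    exists c; first by rewrite -lte_fin.
    apply: filterS VF => j Vj; rewrite -lee_fin -E.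
    by apply: ereal_sup_ubound; exists j.
  (* A supremum equal to -oo would need an empty tail: any witness works. *)
  exists (l - 1); first lra.
  apply: filterS VF => j Vj.
  suff : ((u j)%:E <= -oo)%E by [].
  by rewrite -E; apply: ereal_sup_ubound; exists j.
apply: (@le_lt_trans _ _ c%:E); last by rewrite lte_fin.
apply: ereal_inf_le => //.
exists (ereal_sup [set (u j)%:E | j in [set j | (N <= j)%N]]).
  by exists [set j | (N <= j)%N] => //; exists N.
by apply: ge_ereal_sup => _ [j Nj <-]; rewrite lee_fin uc.
Qed.

Lemma limn_einf_gtP u l : (l%:E < limn_einf (fun j => (u j)%:E))%E <->
  exists2 c, l < c & \forall j \near \oo, c <= u j.
Proof.
rewrite /limn_einf lteNr -EFinN.
have -> : (\- (fun j => (u j)%:E))%E = (fun j => ((- u j)%:E)) by [].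
split=> [/limn_esup_ltP[c cl uc]|[c cl uc]].
  exists (- c); first by rewrite ltrNr.
  by apply: filterS uc => j; rewrite lerNl.
apply/limn_esup_ltP; exists (- c); first by rewrite ltrN2.
by apply: filterS uc => j; rewrite lerN2.
Qed.

Lemma limn_einf_esup_inside (u : nat -> R) :
  ((0 < limn_einf (fun j => (u j)%:E))%E /\
   (limn_esup (fun j => (u j)%:E) < 1)%E) <->
  exists2 e, 0 < e & \forall j \near \oo, e <= u j <= 1 - e.
Proof.
split=> [[/limn_einf_gtP[c1 c10 lo] /limn_esup_ltP[c2 c21 hi]]|[e e0 ue]].
  exists (Num.min c1 (1 - c2)); first by rewrite lt_min c10 subr_gt0.
  apply: filterS2 lo hi => j lo hi; rewrite ge_min lo /= lerBrDl -lerBrDr.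
  by rewrite ge_min lerB ?orbT.
split; [apply/limn_einf_gtP|apply/limn_esup_ltP].
  by exists e => //; apply: filterS ue => j /andP[].
exists (1 - e); first by rewrite gtrBl.
by apply: filterS ue => j /andP[].
Qed.

End Limits.

(** * Powers of the base *)

Section Scales.
Local Set Implicit Arguments.
Local Unset Strict Implicit.
Local Open Scope classical_set_scope.
Local Open Scope ring_scope.
Context {R : realType} {n : nat} (n_ge2 : (2 <= n)%N).

Lemma scale_gt0 (k : int) : (0 : R) < n%:R ^ k.
Proof. by rewrite exprz_gt0// ltr0n ltnW. Qed.

Lemma scaleS (k : int) : n%:R ^ (k + 1) = n%:R * n%:R ^ k :> R.
Proof. by rewrite expfzDr ?pnatr_eq0 -?lt0n 1?ltnW// expr1z mulrC. Qed.

Lemma near_scale_ge (x : R) : \forall j \near \oo, x <= n%:R ^+ j.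
Proof.
exists (Num.truncn `|x|).+1 => // j /= xj.
apply: le_trans (ler_norm x) _.
apply: le_trans (ltW (truncnS_gt `|x|)) _.
by rewrite -natrX ler_nat (leq_trans xj)// ltnW// ltn_expl.
Qed.

(** The integer k is found as a least natural number shifted by N, where N is
    so large that x lies between n^-N and n^N. *)
Lemma scale_bracket (x : R) : 0 < x ->
  exists k : int, n%:R ^ k <= x < n%:R ^ (k + 1).
Proof.
move=> x0.
have [N _ /(_ N (leqnn N)) xN] := near_scale_ge (x + 1 + x^-1).
have ix0 : 0 < x^-1 by rewrite invr_gt0.
have xN1 : x < n%:R ^+ N by lra.
have xN2 : n%:R ^- N <= x.
  have xN3 : x^-1 <= n%:R ^+ N by lra.
  have N0 : (0 : R) < n%:R ^+ N by exact: lt_trans xN1.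
  by rewrite -[leRHS]invrK lef_pV2.
pose P p := x < n%:R ^ (p%:Z - N%:Z).
have exP : exists p, P p.
  exists (N + N)%N; rewrite /P PoszD addrK.
  by rewrite -exprnP.
case: (ex_minnP exP) => -[|p] Pp pmin.
  by move: Pp; rewrite /P sub0r -exprnN; lra.
have pS : p%:Z - N%:Z + 1 = p.+1%:Z - N%:Z by rewrite addrAC -PoszD addn1.
exists (p%:Z - N%:Z); rewrite pS [_ < _]Pp andbT leNgt.
by apply/negP => /pmin; rewrite ltnn.
Qed.

End Scales.

(** * Adjacency as separation of endpoints *)

Section Separation.
Local Set Implicit Arguments.
Local Unset Strict Implicit.
Local Open Scope classical_set_scope.
Local Open Scope ring_scope.
Context {R : realType} {n : nat} (n_ge2 : (2 <= n)%N).
Implicit Types (G : ngrid R n) (Q : set R).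

Lemma len_itvco (x w : R) : 0 < w -> len `[x, x + w[%classic = w%:E.
Proof.
move=> w0; rewrite /len lebesgue_measure_itv /= lte_fin ltrDl w0.
by rewrite -EFinD; congr EFin; ring.
Qed.

(** As Q need not contain its ends, its length is compared with the differences
    of its points: the closed interval between two of them lies in Q. *)
Lemma bounded_interval_len Q :
  is_interval Q -> bounded_set Q -> (0 < len Q)%E ->
  exists l, [/\ 0 < l, len Q = l%:E & forall p q, Q p -> Q q -> q - p <= l].
Proof.
move=> iQ [M [_ bQ]] Q0.
have mQ : measurable Q by rewrite (is_intervalP Q).1 //; exact: measurable_itv.
have QM p : Q p -> `|p| <= `|M| + 1.
  by apply: bQ; rewrite (le_lt_trans (ler_norm M))// ltrDl.
have Qfin : (len Q < +oo)%E.
  apply: (@le_lt_trans _ _ (len `[- (`|M| + 1), `|M| + 1]%classic)).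
    apply: le_measure; rewrite ?inE// => p /QM; rewrite ler_norml.
    by rewrite /= in_itv.
  by rewrite /len lebesgue_measure_itv /=; case: ifP => // _; rewrite ltry.
have QE : len Q = (fine (len Q))%:E.
  by rewrite fineK// ge0_fin_numE// ltW.
exists (fine (len Q)); split => //; first by rewrite -lte_fin -QE.
move=> p q Qp Qq; rewrite -lee_fin -QE.
have [qp|pq] := leP q p.
  by apply: le_trans (ltW Q0); rewrite lee_fin subr_le0.
have -> : (q - p)%:E = len `[p, q]%classic.
  by rewrite /len lebesgue_measure_itv /= lte_fin pq.
apply: le_measure; rewrite ?inE// => z /=; rewrite in_itv /=.
exact: iQ.
Qed.

Lemma ngrid_cell_at G (k : int) (x : R) : exists e,
  ngrid_set G `[e, e + n%:R ^ k[%classic /\ e <= x < e + n%:R ^ k.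
Proof.
have [shape _ _ part] := ngridP G.
have [cov _ _] := part k.
have : [set: R] x by [].
rewrite -cov => -[Q [GQ lQ] Qx].
have [e [f QE]] := shape Q GQ.
have ef : f = e + n%:R ^ k.
  move: lQ; rewrite QE /len lebesgue_measure_itv /= lte_fin.
  have := @scale_gt0 R _ n_ge2 k.
  case: ifP => _ w0 [] wE; first by rewrite -wE; ring.
  by move: w0; rewrite -wE ltxx.
by exists e; rewrite -ef -QE; split=> //; move: Qx; rewrite QE /= in_itv.
Qed.

(** A grid interval with e in its interior contains points just below e, so it
    is not contained in the cell starting at e; as it meets that cell,
    nestedness leaves only the reverse inclusion. *)
Lemma ngrid_cell_sub G (I : set R) (e w r : R) : 0 < w -> 0 < r ->
  ngrid_set G I -> ngrid_set G `[e, e + w[%classic ->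
  `]e - r, e + r[%classic `<=` I -> `[e, e + w[%classic `<=` I.
Proof.
move=> w0 r0 GI GJ eI.
have [_ _ nest _] := ngridP G.
have Ie : I e by apply: eI; rewrite /= in_itv /=; lra.
have Il : I (e - r / 2) by apply: eI; rewrite /= in_itv /=; lra.
have Je : `[e, e + w[%classic e by rewrite /= in_itv /=; lra.
case: (nest _ _ GI GJ) => E.
- by move: Il; rewrite -E => -[_ /=]; rewrite in_itv /=; lra.
- by rewrite -E => z [].
- by have : set0 e by rewrite -E; split.
Qed.

(** Only left ends are compared: two cells of equal length have left ends and
    right ends at the same distance, and every cell of length n^k occurs. *)
Definition separated G1 G2 (c : R) := forall (k : int) (x1 x2 : R),
  ngrid_set G1 `[x1, x1 + n%:R ^ k[%classic ->
  ngrid_set G2 `[x2, x2 + n%:R ^ k[%classic ->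
  c * n%:R ^ k <= `|x1 - x2|.

Lemma ngrid_cell_len_le G (C e w r l : R) (Q I : set R) : 0 < w -> 0 < r ->
  0 <= C -> ngrid_set G `[e, e + w[%classic ->
  `]e - r, e + r[%classic `<=` Q -> len Q = l%:E ->
  Q `<=` I -> (len I <= C%:E * len Q)%E -> ngrid_set G I -> w <= C * l.
Proof.
move=> w0 r0 C0 Ge eQ lQ QI lI GI.
have [shape _ _ _] := ngridP G.
have [x [y IE]] := shape I GI.
rewrite -lee_fin EFinM -lQ; apply: le_trans lI.
rewrite -(@len_itvco e w w0) /len; apply: le_measure; rewrite ?inE//.
  by rewrite IE.
apply: (ngrid_cell_sub w0 r0 GI Ge).
exact: subset_trans QI.
Qed.

(** The test interval covers both left ends x1 and x2 with a margin r.  The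
    margin makes them interior points, so the covering cell has length at least
    w = n^k; choosing r = w / (4C) costs only half of w in the bound
    w <= C (|x1 - x2| + 2r). *)
Lemma adjacent_separated G1 G2 :
  adjacent_grids G1 G2 -> exists2 c, 0 < c & separated G1 G2 c.
Proof.
move=> [C C0 adj]; exists (2 * C)^-1; first by rewrite invr_gt0; lra.
move=> k x1 x2 G1x G2x; set w := n%:R ^ k in G1x G2x *.
have w0 : 0 < w by exact: scale_gt0.
set r := w / (4 * C).
have r0 : 0 < r by rewrite divr_gt0//; lra.
set d := `|x1 - x2|.
have d0 : 0 <= d by exact: normr_ge0.
have dE : Num.max x1 x2 - Num.min x1 x2 = d.
  rewrite /d; case: (leP x1 x2) => ?; first by rewrite ler0_norm; lra.
  by rewrite gtr0_norm; lra.
set lo := Num.min x1 x2 - r; set hi := Num.max x1 x2 + r.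
have lohi : hi - lo = d + 2 * r by rewrite /hi /lo -dE; ring.
pose Q : set R := `]lo, hi[%classic.
have lQ : len Q = (d + 2 * r)%:E.
  have lh : lo < hi by lra.
  by rewrite /len lebesgue_measure_itv /= lte_fin lh -EFinD lohi.
have min1 : Num.min x1 x2 <= x1 by rewrite ge_min lexx.
have min2 : Num.min x1 x2 <= x2 by rewrite ge_min lexx orbT.
have max1 : x1 <= Num.max x1 x2 by rewrite le_max lexx.
have max2 : x2 <= Num.max x1 x2 by rewrite le_max lexx orbT.
have Q1 : `]x1 - r, x1 + r[%classic `<=` Q.
  by move=> z /=; rewrite /Q /= !in_itv /= /lo /hi; lra.
have Q2 : `]x2 - r, x2 + r[%classic `<=` Q.
  by move=> z /=; rewrite /Q /= !in_itv /= /lo /hi; lra.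
have [||| I [QI lI GI]] := adj Q.
- exact: interval_is_interval.
- exists (`|lo| + `|hi|); split=> // M hM z /=; rewrite /Q /= in_itv /=.
  have := ler_norm hi; have := ler_norm (- lo); rewrite normrN.
  have := normr_ge0 hi; have := normr_ge0 lo.
  by rewrite ler_norml; lra.
- by rewrite lQ lte_fin; lra.
have wC : w <= C * (d + 2 * r).
  case: GI => GI.
    exact: (@ngrid_cell_len_le G1 C x1 w r _ Q I w0 r0 (ltW C0) G1x).
  exact: (@ngrid_cell_len_le G2 C x2 w r _ Q I w0 r0 (ltW C0) G2x).
have rE : C * (2 * r) = w / 2 by rewrite /r; field; rewrite gt_eqF.
rewrite mulrC ler_pdivrMr; last lra.
by move: wC; rewrite mulrDr rE; lra.
Qed.

(** The scale w is the least power of n with l < c w, hence w <= (n / c) l.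
    Starting both cells at the infimum of Q forces Q to leave each of them
    through its right end. *)
Lemma separated_adjacent G1 G2 c : 0 < c -> separated G1 G2 c ->
  adjacent_grids G1 G2.
Proof.
move=> c0 sep.
have n0 : (0 : R) < n%:R by rewrite ltr0n ltnW.
exists (n%:R / c); first by rewrite divr_gt0.
move=> Q iQ bQ Q0.
have [l [l0 lQ Ql]] := bounded_interval_len iQ bQ Q0.
have [k /andP[kl lk]] := scale_bracket n_ge2 (divr_gt0 l0 c0).
set w : R := n%:R ^ (k + 1) in lk.
have w0 : 0 < w by exact: scale_gt0.
have wl : w <= n%:R / c * l.
  by rewrite /w scaleS// mulrAC -mulrA ler_pM2l.
have lw : l < c * w by move: lk; rewrite ltr_pdivrMr// mulrC.
have Qn0 : Q !=set0.
  by apply/set0P/eqP => QE; move: Q0; rewrite QE /len measure0 ltxx.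
have [q0 Qq0] := Qn0.
have Qlb : has_lbound Q.
  by exists (q0 - l) => p Qp; rewrite lerBlDl -lerBlDr; exact: Ql.
have infQ p : Q p -> inf Q <= p <= inf Q + l.
  move=> Qp; rewrite ge_inf// -lerBlDr; apply: lb_le_inf => // q Qq.
  by rewrite lerBlDl -lerBlDr; exact: Ql.
have [e1 [G1e e1Q]] := ngrid_cell_at G1 (k + 1) (inf Q).
have [e2 [G2e e2Q]] := ngrid_cell_at G2 (k + 1) (inf Q).
rewrite -/w in e1Q e2Q G1e G2e.
have lenI e : (len `[e, (e + w)%R[%classic <= (n%:R / c)%:E * len Q)%E.
  by rewrite len_itvco// lQ -EFinM lee_fin.
have esc e : e <= inf Q < e + w -> ~ (Q `<=` `[e, e + w[%classic) ->
    inf Q < e + w <= inf Q + l.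
  move=> /andP[eQ Qe] /existsNP[q /not_implyP[Qq]].
  move: (infQ q Qq); rewrite /= in_itv /= => /andP[q1 q2] /negP.
  by rewrite (le_trans eQ q1) /= -leNgt => weq; rewrite Qe (le_trans weq).
have [Q1|/(esc _ e1Q) Q1] := pselect (Q `<=` `[e1, e1 + w[%classic).
  by exists `[e1, e1 + w[%classic; split=> //; left.
have [Q2|/(esc _ e2Q) Q2] := pselect (Q `<=` `[e2, e2 + w[%classic).
  by exists `[e2, e2 + w[%classic; split=> //; right.
have := sep _ _ _ G1e G2e; rewrite -/w => sw.
have : `|e1 - e2| < l by rewrite ltr_norml; lra.
by move: sw; lra.
Qed.

End Separation.

(** * Separation of location grids *)

Section LocationGrids.
Local Set Implicit Arguments.
Local Unset Strict Implicit.
Local Open Scope classical_set_scope.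
Local Open Scope ring_scope.
Context {R : realType} {n : nat} (n_ge2 : (2 <= n)%N).
Implicit Types (a b : nat -> 'I_n) (d : R) (m k : int).

Lemma itvco_eq (x y v w : R) : 0 < v -> 0 < w ->
  `[x, x + v[%classic = `[y, y + w[%classic -> x = y /\ v = w.
Proof.
move=> v0 w0 E.
have xy : y <= x.
  have : `[y, y + w[%classic x by rewrite -E /= in_itv /=; lra.
  by rewrite /= in_itv /= => /andP[].
have yx : x <= y.
  have : `[x, x + v[%classic y by rewrite E /= in_itv /=; lra.
  by rewrite /= in_itv /= => /andP[].
split; first lra.
by have := len_itvco x v0; rewrite E len_itvco// => -[].
Qed.

(** The generation of a cell is determined by its length, so a cell of length
    n^k can only come from generation -k. *)
Lemma location_grid_cell d a k x :
  ngrid_set (location_grid n_ge2 d a) `[x, x + n%:R ^ k[%classic <->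
  exists i : int, x = generation_origin d (location a) (- k) + i%:~R * n%:R ^ k.
Proof.
have cellE m i : `[generation_origin d (location a) m + i%:~R / n%:R ^ m,
    generation_origin d (location a) m + (i + 1)%:~R / n%:R ^ m[%classic =
    `[generation_origin d (location a) m + i%:~R * n%:R ^ (- m),
    generation_origin d (location a) m + i%:~R * n%:R ^ (- m)
      + n%:R ^ (- m)[%classic :> set R.
  by rewrite intrD invr_expz mulrDl mul1r addrA.
split=> [[m _ [i]]|[i ->]].
  rewrite cellE.
  move=> /(itvco_eq (scale_gt0 n_ge2 k) (scale_gt0 n_ge2 (- m)))[-> E].
  have -> : k = - m.
    move: E; apply: ieexprIz; rewrite ?ltr0n ?(ltnW n_ge2)//.
    by rewrite pnatr_eq1 gtn_eqF.
  by exists i; rewrite opprK.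
by exists (- k) => //; exists i; rewrite cellE opprK.
Qed.

Lemma separated_location_grid d1 d2 a b c :
  separated (location_grid n_ge2 d1 a) (location_grid n_ge2 d2 b) c <->
  forall m k, c / n%:R ^ m <=
    `|generation_origin d1 (location a) m - generation_origin d2 (location b) m
      - k%:~R / n%:R ^ m|.
Proof.
split=> [sep m k|
  sep p x1 x2 /location_grid_cell[i ->] /location_grid_cell[j ->]].
  set o1 := generation_origin d1 _ m; set o2 := generation_origin d2 _ m.
  have := sep (- m) o1 (o2 + k%:~R * n%:R ^ (- m)).
  rewrite invr_expz opprD addrA; apply; apply/location_grid_cell; rewrite opprK.
    by exists 0; rewrite mul0r addr0.
  by exists k.
have := sep (- p) (j - i); rewrite invr_expz opprK intrB.
by congr (_ <= `|_|); ring.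
Qed.

(** Splits the scales at 1 and unfolds the origins: the location functions
    enter only at the coarse scales n^j.  The coarse case includes j = 0, where
    it repeats m = 0 because both location functions vanish. *)
Lemma separated_location_gridP d1 d2 a b c :
  separated (location_grid n_ge2 d1 a) (location_grid n_ge2 d2 b) c <->
  (forall m k, 0 <= m -> c / n%:R ^ m <= `|d1 - d2 - k%:~R / n%:R ^ m|) /\
  (forall (j : nat) k, c * n%:R ^+ j <= `|d1 - d2 +
     ((location a j)%:R - (location b j)%:R) - k%:~R * n%:R ^+ j|).
Proof.
rewrite separated_location_grid /generation_origin.
have shuffle (x y : R) : d1 + x - (d2 + y) = d1 - d2 + (x - y) by ring.
split=> [sep|[fine coarse] m k].
  split=> [m k m0|[|j] k]; first by have := sep m k; rewrite m0.
    have := sep 0 k; rewrite lexx expr0z invr1.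
    by rewrite /location !big_ord0 expr0 subrr addr0.
  by have := sep (- j.+1%:Z) k; rewrite oppr_ge0 /= shuffle -exprnN invrK.
case: ifPn => [|]; first exact: fine.
case: m => // j _; have := coarse j.+1 k.
by rewrite NegzE /= shuffle -exprnN invrK.
Qed.

Lemma is_farP d : is_far n d <-> exists2 C : R, 0 < C &
  (forall m k, 0 <= m -> C / n%:R ^ m <= `|d - k%:~R / n%:R ^ m|) /\
  (forall (j : nat) k, k != 0 -> C * n%:R ^+ j <= `|d - k%:~R * n%:R ^+ j|).
Proof.
split=> -[C C0 far]; exists C => //.
  split=> [m k m0|[|j] k k0]; first by apply: far; left.
    by have := far 0 k; rewrite expr0z invr1 expr0; apply; left.
  have := far (- j.+1%:Z) k; rewrite -exprnN invrK; apply; right.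
  by rewrite oppr_lt0.
case: far => fine coarse m k [|[m0 k0]]; first exact: fine.
by case: m m0 => // j _; rewrite NegzE -exprnN invrK coarse.
Qed.

Lemma location_lt a j : (location a j < n ^ j)%N.
Proof.
elim: j => [|j IH]; first by rewrite /location big_ord0 expn0.
rewrite /location big_ord_recr /= -/(location a j) expnS.
by rewrite (leq_trans _ (leq_mul (ltn_ord (a j)) (leqnn _)))// mulSn ltn_add2r.
Qed.

Lemma location_gapE a b j : location_gap R a b j =
  `|(location a j)%:R - (location b j)%:R| / n%:R ^+ j.
Proof. by rewrite /location_gap normf_div normrX normr_nat. Qed.

Lemma location_sub_lt a b j :
  `|(location a j)%:R - (location b j)%:R| < n%:R ^+ j :> R.
Proof.
have := location_lt a j; have := location_lt b j.
rewrite -!(ltr_nat R) natrX => La Lb.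
have := ler0n R (location a j); have := ler0n R (location b j).
by move=> ? ?; rewrite ltr_norml; lra.
Qed.

Lemma le_norm_multiple (w : R) k : 0 < w -> k != 0 -> w <= `|k%:~R * w|.
Proof.
move=> w0 k0; rewrite normrM (gtr0_norm w0) ler_peMl ?(ltW w0)//.
by rewrite -intr_norm -[1]/(1%:~R) ler_int -gtz0_ge1 normr_gt0.
Qed.

Lemma dist_multiple_ge (x e w : R) k : 0 < w -> e * w <= `|x| <= (1 - e) * w ->
  e * w <= `|x - k%:~R * w|.
Proof.
move=> w0 /andP[ex xe]; have [->|k0] := eqVneq k 0.
  by rewrite mul0r subr0.
have kw := le_norm_multiple w0 k0.
by have := lerB_dist (k%:~R * w) x; rewrite [leRHS]distrC; lra.
Qed.

(** Multiples of n^j are integers, so the inequality at scale 1 serves for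
    boundedly many coarse scales n^j once its constant is divided by the
    largest of them. *)
Lemma dist_int_ge_coarse d (c : R) J : 0 < c ->
  (forall K : int, c <= `|d - K%:~R|) -> forall j (K : int), (j <= J)%N ->
  c / n%:R ^+ J * n%:R ^+ j <= `|d - K%:~R|.
Proof.
move=> c0 dK j K jJ; apply: le_trans (dK K).
have n0 : (0 : R) < n%:R by rewrite ltr0n ltnW.
rewrite mulrAC ler_pdivrMr ?exprn_gt0// ler_pM2l//.
by rewrite ler_eXn2l// ltr1n.
Qed.

(** Scales up to n^J follow from m = 0; beyond, |d| is at most half of n^j while
    a nonzero multiple of n^j has absolute value at least n^j. *)
Lemma separated_is_far d1 d2 a b c : 0 < c ->
  separated (location_grid n_ge2 d1 a) (location_grid n_ge2 d2 b) c ->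
  is_far n (d1 - d2).
Proof.
move=> c0 /separated_location_gridP[fine _]; apply/is_farP.
set d := d1 - d2 in fine *.
have n0 j : (0 : R) < n%:R ^+ j by rewrite exprn_gt0// ltr0n ltnW.
have [J _ dJ] := near_scale_ge n_ge2 (2 * `|d|).
have dK (K : int) : c <= `|d - K%:~R|.
  by have := fine 0 K (lexx _); rewrite expr0z invr1 !mulr1.
have cJ := @dist_int_ge_coarse d c J c0 dK.
have cJ0 : 0 < c / n%:R ^+ J by rewrite divr_gt0.
exists (Num.min (c / n%:R ^+ J) (1 / 2)).
  by rewrite lt_min cJ0 divr_gt0.
split=> [m k m0|j k k0].
  apply: le_trans (fine m k m0); rewrite ler_pM2r ?invr_gt0 ?scale_gt0//.
  rewrite ge_min ler_pdivrMr// ler_peMr ?(ltW c0)//.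
  by rewrite exprn_ege1// ler1n ltnW.
have [jJ|/ltnW Jj] := leqP j J.
  have := cJ j (k * n%:Z ^+ j) jJ; rewrite intrM rmorphXn /= => H.
  by apply: le_trans H; rewrite ler_pM2r// ge_min lexx.
have dj := dJ j Jj; have nj := n0 j.
apply: (@le_trans _ _ (1 / 2 * n%:R ^+ j)).
  by rewrite ler_pM2r// ge_min lexx orbT.
rewrite distrC; apply: le_trans (lerB_dist _ _).
have kw := le_norm_multiple nj k0.
by move: dj kw; lra.
Qed.

(** Once |d| <= (c / 2) n^j, dropping d from the separation costs half of the
    constant; k = 0 bounds the gap from below, and k = 1 or -1, according to the
    sign of the difference, bounds it from above. *)
Lemma separated_gap d1 d2 a b c : 0 < c ->
  separated (location_grid n_ge2 d1 a) (location_grid n_ge2 d2 b) c ->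
  \forall j \near \oo, c / 2 <= location_gap R a b j <= 1 - c / 2.
Proof.
move=> c0 /separated_location_gridP[_ coarse].
have [J _ dJ] := near_scale_ge n_ge2 (2 * `|d1 - d2| / c).
exists J => // j /= /dJ {}dJ.
have nj : (0 : R) < n%:R ^+ j by rewrite exprn_gt0// ltr0n ltnW.
rewrite location_gapE ler_pdivlMr// ler_pdivrMr//.
move: dJ; rewrite ler_pdivrMr// => dJ.
have := location_sub_lt a b j.
move: (coarse j 0) (coarse j 1) (coarse j (- 1)).
rewrite mul0r subr0 mul1r mulrNz mulN1r opprK.
move: ((location a j)%:R - _) (d1 - d2) (n%:R ^+ j) dJ nj.
move=> g d w dw w0 h0 h1 h2 gw.
have := ler_normD d g.
have [g0|g0] := leP 0 g.
  have := ler_normD d (g - w); rewrite addrA.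
  rewrite (ger0_norm g0) in gw *; rewrite [`|g - w|]ler0_norm; last lra.
  by move: h0 h1 dw; lra.
have := ler_normD d (g + w); rewrite addrA.
rewrite (ltr0_norm g0) in gw *; rewrite [`|g + w|]ger0_norm; last lra.
by move: h0 h2 dw; lra.
Qed.

(** Large j come from the gap, with half of the constant e given up to absorb
    d; the finitely many others come from farness at m = 0, the difference of
    the location functions being an integer. *)
Lemma far_gap_separated d1 d2 a b e : is_far n (d1 - d2) -> 0 < e ->
  (\forall j \near \oo, e <= location_gap R a b j <= 1 - e) ->
  exists2 c, 0 < c &
    separated (location_grid n_ge2 d1 a) (location_grid n_ge2 d2 b) c.
Proof.
move=> /is_farP[C C0 [fine _]] e0 gap; set d := d1 - d2 in fine.
have n0 j : (0 : R) < n%:R ^+ j by rewrite exprn_gt0// ltr0n ltnW.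
have [J _ tail] : \forall j \near \oo,
    `|d| / (e / 2) <= n%:R ^+ j /\ e <= location_gap R a b j <= 1 - e.
  by apply: filterS2 (near_scale_ge n_ge2 (`|d| / (e / 2))) gap.
have dK (K : int) : C <= `|d - K%:~R|.
  by have := fine 0 K (lexx _); rewrite expr0z invr1 !mulr1.
have CJ := @dist_int_ge_coarse d C J C0 dK.
have CJ0 : 0 < C / n%:R ^+ J by rewrite divr_gt0.
exists (Num.min (C / n%:R ^+ J) (e / 2)).
  by rewrite lt_min CJ0 divr_gt0.
apply/separated_location_gridP; rewrite -/d; split=> [m k m0|j k].
  apply: le_trans (fine m k m0); rewrite ler_pM2r ?invr_gt0 ?scale_gt0//.
  rewrite ge_min ler_pdivrMr// ler_peMr ?(ltW C0)//.
  by rewrite exprn_ege1// ler1n ltnW.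
have [jJ|/ltnW Jj] := leqP j J.
  have := CJ j (k * n%:Z ^+ j - ((location a j)%:Z - (location b j)%:Z)) jJ.
  rewrite !intrB intrM rmorphXn /= opprB addrA addrAC addrA => H.
  apply: (@le_trans _ _ (C / n%:R ^+ J * n%:R ^+ j)).
    by rewrite ler_pM2r// ge_min lexx.
  by apply: le_trans H _; rewrite le_eqVlt; apply/orP; left; apply/eqP;
     congr `|_|; ring.
have [dw] := tail j Jj; rewrite location_gapE ler_pdivlMr// ler_pdivrMr//.
move=> /(dist_multiple_ge k (n0 j)) gx.
rewrite ler_pdivrMr in dw; last lra.
apply: (@le_trans _ _ (e / 2 * n%:R ^+ j)).
  by rewrite ler_pM2r// ge_min lexx orbT.
move: dw gx; move: (_%:R - _) (k%:~R * _) => g x dw gx.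
rewrite -addrA addrC; have := lerB_normD (g - x) d.
by move: dw gx; lra.
Qed.

End LocationGrids.

(** * The characterization *)

Theorem theorem3p8 (R : realType) (n : nat) (n_ge2 : (2 <= n)%N)
    (delta1 delta2 : R) (a b : nat -> 'I_n) :
  adjacent_grids (location_grid n_ge2 delta1 a) (location_grid n_ge2 delta2 b) <->
  is_far n (delta1 - delta2) /\
  [/\ (0 < limn_einf (fun j => (location_gap R a b j)%:E))%E,
      (limn_einf (fun j => (location_gap R a b j)%:E) <=
       limn_esup (fun j => (location_gap R a b j)%:E))%E
    & (limn_esup (fun j => (location_gap R a b j)%:E) < 1)%E].
Proof.
split=> [/(adjacent_separated n_ge2)[c c0 sep]|[far [lo _ hi]]].
  have [|lo hi] := (limn_einf_esup_inside (location_gap R a b)).2.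
    by exists (c / 2); [rewrite divr_gt0|exact: separated_gap c0 sep].
  split; first exact: separated_is_far c0 sep.
  by split=> //; exact: limn_einf_sup.
have [e e0 gap] := (limn_einf_esup_inside _).1 (conj lo hi).
have [c c0 sep] := far_gap_separated n_ge2 far e0 gap.
exact: separated_adjacent c0 sep.
Qed.
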